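(* Let $N$ be a $2n$-dimensional smooth manifold with a pseudo-Riemannian metric $g$ and a linear connection $\nabla$, and let $(g,\omega,J)$ be a compatible triple on $N$. Let $\nabla^{*}$, $\nabla^{\dagger}$ and $\nabla^{J}$ denote respectively the $g$-conjugate, $\omega$-conjugate and $J$-conjugate connections of $\nabla$. Then: (i) $d^{\nabla}\omega=0\Leftrightarrow T^{\nabla^{\dagger}}=0\Leftrightarrow d^{\nabla^{*}}J=0\Leftrightarrow d^{\nabla^{J}}g=0$; (ii) $d^{\nabla^{*}}\omega=0\Leftrightarrow T^{\nabla^{J}}=0\Leftrightarrow d^{\nabla}J=0\Leftrightarrow d^{\nabla^{\dagger}}g=0$; (iii) $d^{\nabla^{\dagger}}\omega=0\Leftrightarrow T^{\nabla}=0\Leftrightarrow d^{\nabla^{J}}J=0\Leftrightarrow d^{\nabla^{*}}g=0$; (iv) $d^{\nabla^{J}}\omega=0\Leftrightarrow T^{\nabla^{*}}=0\Leftrightarrow d^{\nabla^{\dagger}}J=0\Leftrightarrow d^{\nabla}g=0$.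
   Context: Compatible triple $(g,\omega,J)$: $J$ is an almost complex structure ($J^2=-\mathrm{id}$), $g$ is a pseudo-Riemannian metric with $g(JX,Y)=-g(X,JY)$, and $\omega(X,Y)=g(JX,Y)$. Conjugate connections of $\nabla$ (for all vector fields $X,Y,Z$): $Zg(X,Y)=g(\nabla_ZX,Y)+g(X,\nabla^{*}_ZY)$; $Z\omega(X,Y)=\omega(\nabla_ZX,Y)+\omega(X,\nabla^{\dagger}_ZY)$; $\nabla^{J}_XY=J^{-1}(\nabla_X(JY))$. For any linear connection $D$: $T^{D}(X,Y)=D_XY-D_YX-[X,Y]$; $(d^{D}J)(X,Y)=(D_XJ)Y-(D_YJ)X+J\,T^{D}(X,Y)$, where $(D_XJ)Y=D_X(JY)-JD_XY$; and for $b=g$ or $b=\omega$, $(d^{D}b)(X,Y,Z)=(D_Xb)(Y,Z)-(D_Yb)(X,Z)+b(T^{D}(X,Y),Z)$. *)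

(* Defs.v *)
(* Smooth manifolds are given by atlases; tensor calculus follows S. Helgason,
   "Differential Geometry, Lie Groups, and Symmetric Spaces", Ch. I: a vector
   field is a derivation of the algebra C^oo(M), the tangent space at p is the
   space of all X_p : f |-> (X f)(p) with X a vector field, and tensor fields
   are C^oo(M)-multilinear maps on the module of vector fields. *)
From HB Require Import structures.
From mathcomp Require Import all_boot all_order all_algebra.
From mathcomp Require Import all_classical all_reals all_analysis.
From mathcomp Require Import ring.

Set Implicit Arguments.
Unset Strict Implicit.
Unset Printing Implicit Defensive.

Import Order.TTheory GRing.Theory Num.Theory.
Import numFieldNormedType.Exports.
Local Open Scope classical_set_scope.
Local Open Scope ring_scope.

Section Smooth.
Context {R : realType} {m : nat}.
Implicit Types (U : set 'rV[R]_m) (f g : 'rV[R]_m -> R).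

(* Only meant for open [U]; the values of [f] outside [U] are then irrelevant
   (lemma [Ck_eq]). *)
Fixpoint Ck (k : nat) U f : Prop :=
  (forall x, U x -> {for x, continuous f}) /\
  if k is k'.+1 then
    forall i : 'I_m, (forall x, U x -> derivable f x (delta_mx ord0 i)) /\
      Ck k' U ('D_(delta_mx ord0 i) f)
  else True.

Definition smooth_on U f : Prop := forall k, Ck k U f.

Definition smooth_map_on {m' : nat} U (F : 'rV[R]_m -> 'rV[R]_m') : Prop :=
  forall j : 'I_m', smooth_on U (fun x => F x ord0 j).

Lemma Ck_eq k U f g : open U -> (forall x, U x -> f x = g x) ->
  Ck k U f -> Ck k U g.
Proof.
move=> oU; have near_fg f' g' : (forall x, U x -> f' x = g' x) ->
    forall x, U x -> \forall y \near x, f' y = g' y.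
  by move=> fg x Ux; move: (open_nbhs_nbhs (conj oU Ux)); apply: filterS.
have cont_fg f' g' : (forall x, U x -> f' x = g' x) ->
    (forall x, U x -> {for x, continuous f'}) ->
    forall x, U x -> {for x, continuous g'}.
  move=> fg fc x Ux; have := fc x Ux.
  rewrite /prop_for /continuous_at (fg x Ux) => fx.
  exact: cvg_trans (near_eq_cvg (near_fg _ _ fg x Ux)) fx.
elim: k f g => [|k IHk] f g fg /= [fc fD]; (split; first exact: cont_fg fc) => //.
move=> i; have [fi Dfi] := fD i; split=> [x Ux|].
  exact: near_eq_derivable (near_fg _ _ fg x Ux) (fi x Ux).
by apply: IHk Dfi => x Ux; exact: near_eq_derive (near_fg _ _ fg x Ux).
Qed.

Lemma CkW k U f : Ck k.+1 U f -> Ck k U f.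
Proof.
elim: k f => [|k IHk] f [fc fD]; split=> // i.
by have [fi Dfi] := fD i; split=> //; exact: IHk.
Qed.

Lemma Ck_cst k U (c : R) : Ck k U (cst c).
Proof.
elim: k c => [|k IHk] c; (split; first by move=> x _; exact: cst_continuous).
  by [].
move=> i; split=> [x _|]; first exact: derivable_cst.
rewrite (_ : 'D_ _ _ = cst 0); first exact: IHk.
by apply/funext => x; rewrite derive_cst.
Qed.

Lemma CkD k U f g : open U -> Ck k U f -> Ck k U g -> Ck k U (f + g).
Proof.
move=> oU; elim: k f g => [|k IHk] f g [fc fD] [gc gD].
  by split=> // x Ux; apply: continuousD; [exact: fc|exact: gc].
split=> [x Ux|i]; first by apply: continuousD; [exact: fc|exact: gc].
have [fi Dfi] := fD i; have [gi Dgi] := gD i.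
split=> [x Ux|]; first by apply: derivableD; [exact: fi|exact: gi].
apply: (Ck_eq oU _ (IHk _ _ Dfi Dgi)) => x Ux.
by rewrite deriveD; [|exact: fi|exact: gi].
Qed.

Lemma CkM k U f g : open U -> Ck k U f -> Ck k U g -> Ck k U (f * g).
Proof.
move=> oU; elim: k f g => [|k IHk] f g fk gk.
  case: fk gk => [fc _] [gc _].
  by split=> // x Ux; apply: continuousM; [exact: fc|exact: gc].
have [fk' gk'] := (CkW fk, CkW gk); case: fk gk => [fc fD] [gc gD].
split=> [x Ux|i]; first by apply: continuousM; [exact: fc|exact: gc].
have [fi Dfi] := fD i; have [gi Dgi] := gD i.
split=> [x Ux|]; first by apply: derivableM; [exact: fi|exact: gi].
apply: (Ck_eq oU _ (CkD oU (IHk _ _ fk' Dgi) (IHk _ _ gk' Dfi))) => x Ux.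
by rewrite deriveM; [|exact: fi|exact: gi].
Qed.

End Smooth.

(* [chart_inv] is relevant only on the image of [chart_dom]. *)
Record chart (R : realType) (m : nat) (M : topologicalType) := Chart {
  chart_dom : set M;
  chart_map : M -> 'rV[R]_m;
  chart_inv : 'rV[R]_m -> M;
  chart_dom_open : open chart_dom;
  chart_img_open : open (chart_map @` chart_dom);
  chart_mapK : forall p, chart_dom p -> chart_inv (chart_map p) = p;
  chart_map_cont : forall p, chart_dom p -> {for p, continuous chart_map};
  chart_inv_cont : forall x, (chart_map @` chart_dom) x ->
    {for x, continuous chart_inv} }.

Arguments chart_dom_open {R m M} c.
Arguments chart_img_open {R m M} c.

(* The atlas need not be maximal: it determines a unique maximal one, with the
   same smooth functions. *)
Record manifold (R : realType) (m : nat) := Manifold {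
  carrier :> topologicalType;
  atlas : set (chart R m carrier);
  manifold_hausdorff : hausdorff_space carrier;
  manifold_second_countable : @second_countable carrier;
  atlas_cover : forall p : carrier, exists2 c, atlas c & chart_dom c p;
  atlas_smooth : forall c d, atlas c -> atlas d ->
    smooth_map_on (chart_map c @` (chart_dom c `&` chart_dom d))
                  (chart_map d \o chart_inv c) }.

Section SmoothFunctions.
Context {R : realType} {m : nat} (M : manifold R m).

Definition smooth_fun (f : M -> R) : Prop := forall c, atlas c ->
  smooth_on (chart_map c @` chart_dom c) (f \o chart_inv c).

Definition smooth_fun_pred : {pred M -> R} := fun f => `[< smooth_fun f >].

Lemma smooth_fun_pred_subring : subring_closed smooth_fun_pred.
Proof.
have cstP (a : R) : smooth_fun (cst a) by move=> c _ k; exact: Ck_cst.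
have MP f g : smooth_fun f -> smooth_fun g -> smooth_fun (f * g).
  move=> sf sg c cA k.
  have -> : (f * g) \o chart_inv c = (f \o chart_inv c) * (g \o chart_inv c) by [].
  exact: CkM (chart_img_open c) (sf c cA k) (sg c cA k).
split; first by apply/asboolP; exact: cstP.
  move=> f g /asboolP sf /asboolP sg; apply/asboolP => c cA k.
  rewrite (_ : f - g = f + cst (- 1) * g); last first.
    by apply/funext => x; rewrite /GRing.mul /GRing.add /GRing.opp /= mulN1r.
  have -> : (f + cst (- 1) * g) \o chart_inv c =
    (f \o chart_inv c) + ((cst (- 1) * g) \o chart_inv c) by [].
  exact: CkD (chart_img_open c) (sf c cA k) (MP _ _ (cstP _) sg c cA k).
by move=> f g /asboolP sf /asboolP sg; apply/asboolP; exact: MP.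
Qed.

Record Cinf := MkCinf { Cinf_fun :> M -> R; _ : Cinf_fun \in smooth_fun_pred }.

HB.instance Definition _ := [isSub for Cinf_fun].
HB.instance Definition _ := [Choice of Cinf by <:].
HB.instance Definition _ := GRing.SubChoice_isSubComPzRing.Build
  (M -> R) smooth_fun_pred Cinf smooth_fun_pred_subring.

Lemma cst_smooth (a : R) : cst a \in smooth_fun_pred.
Proof. by apply/asboolP => c _ k; exact: Ck_cst. Qed.

Definition Cinf_cst (a : R) : Cinf := MkCinf (cst_smooth a).

Lemma CinfP (f g : Cinf) : (forall p, f p = g p) -> f = g.
Proof. by move=> fg; apply/val_inj/funext => p; exact: fg. Qed.

Lemma Cinf_add (f g : Cinf) p : (f + g) p = f p + g p. Proof. by []. Qed.
Lemma Cinf_opp (f : Cinf) p : (- f) p = - f p. Proof. by []. Qed.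
Lemma Cinf_mul (f g : Cinf) p : (f * g) p = f p * g p. Proof. by []. Qed.

Let scaleA (a b : R) (f : Cinf) :
  Cinf_cst a * (Cinf_cst b * f) = Cinf_cst (a * b) * f.
Proof. by apply/CinfP => p; rewrite !Cinf_mul /= mulrA. Qed.
Let scale1 : left_id 1 (fun a (f : Cinf) => Cinf_cst a * f).
Proof. by move=> f; apply/CinfP => p; rewrite Cinf_mul /= mul1r. Qed.
Let scaleDr : right_distributive (fun a (f : Cinf) => Cinf_cst a * f) +%R.
Proof. by move=> a f g; rewrite mulrDr. Qed.
Let scaleDl (f : Cinf) :
  {morph (fun a => Cinf_cst a * f) : a b / a + b}.
Proof. by move=> a b; apply/CinfP => p; rewrite Cinf_add !Cinf_mul /= mulrDl. Qed.

HB.instance Definition _ := GRing.Zmodule_isLmodule.Build R Cinf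
  scaleA scale1 scaleDr scaleDl.

Lemma Cinf_scale (a : R) (f : Cinf) p : (a *: f) p = a * f p.
Proof. by []. Qed.

End SmoothFunctions.

Section VectorFields.
Context {R : realType} {m : nat} (M : manifold R m).
Local Notation C := (Cinf M).

Definition derivation (X : C -> C) : Prop :=
  (forall (a : R) f g, X (a *: f + g) = a *: X f + X g) /\
  (forall f g, X (f * g) = X f * g + f * X g).

Definition derivation_pred : {pred C -> C} := fun X => `[< derivation X >].

Lemma derivation_pred_zmod : zmod_closed derivation_pred.
Proof.
split.
  apply/asboolP; split=> [a f g|f g]; first by rewrite /GRing.zero /= scaler0 addr0.
  by rewrite /GRing.zero /= mul0r mulr0 addr0.
move=> X Y /asboolP[Xl XM] /asboolP[Yl YM]; apply/asboolP; split=> [a f g|f g].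
  rewrite -![(X - Y) _]/(X _ - Y _) Xl Yl scalerBr opprD.
  by rewrite addrACA.
rewrite -![(X - Y) _]/(X _ - Y _) XM YM mulrBl mulrBr opprD.
by rewrite addrACA.
Qed.

HB.instance Definition _ := GRing.isZmodClosed.Build (C -> C)
  derivation_pred derivation_pred_zmod.

Record vfield :=
  MkVfield { vfield_fun :> C -> C; _ : vfield_fun \in derivation_pred }.

HB.instance Definition _ := [isSub for vfield_fun].
HB.instance Definition _ := [Choice of vfield by <:].
HB.instance Definition _ := [SubChoice_isSubZmodule of vfield by <:].

Implicit Types (X Y : vfield) (f g h : C).

Lemma vfield_derivation X : derivation X.
Proof. by apply/asboolP; exact: (valP X). Qed.

Lemma vfieldP X Y : (forall f, X f = Y f) -> X = Y.
Proof. by move=> XY; apply/val_inj/funext. Qed.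

Lemma vfield_add X Y f : (X + Y) f = X f + Y f. Proof. by []. Qed.
Lemma vfield_opp X f : (- X) f = - X f. Proof. by []. Qed.

Lemma vfield_scale_subproof h X : (fun f => h * X f) \in derivation_pred.
Proof.
have [Xl XM] := vfield_derivation X.
apply/asboolP; split=> [a f g|f g].
  by rewrite Xl mulrDr; congr (_ + _); exact: mulrCA.
by rewrite XM mulrDr mulrA mulrCA.
Qed.

Definition vfield_scale h X : vfield := MkVfield (vfield_scale_subproof h X).

Let scaleA f g X : vfield_scale f (vfield_scale g X) = vfield_scale (f * g) X.
Proof. by apply/vfieldP => h /=; rewrite mulrA. Qed.
Let scale1 : left_id 1 vfield_scale.
Proof. by move=> X; apply/vfieldP => h /=; rewrite mul1r. Qed.
Let scaleDr : right_distributive vfield_scale +%R.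
Proof. by move=> f X Y; apply/vfieldP => h; rewrite vfield_add /= -mulrDr. Qed.
Let scaleDl X : {morph vfield_scale^~ X : f g / f + g}.
Proof. by move=> f g; apply/vfieldP => h; rewrite vfield_add /= -mulrDl. Qed.

HB.instance Definition _ := GRing.Zmodule_isLmodule.Build C vfield
  scaleA scale1 scaleDr scaleDl.

Lemma vfield_scaleE f X g : (f *: X) g = f * X g. Proof. by []. Qed.

Lemma vfieldD X f g : X (f + g) = X f + X g.
Proof.
have [Xl _] := vfield_derivation X.
by have := Xl 1 f g; rewrite !scale1r.
Qed.

Lemma vfieldN X f : X (- f) = - X f.
Proof.
have X0 : X 0 = 0 by apply: (addrI (X 0)); rewrite -vfieldD !addr0.
by apply: (addrI (X f)); rewrite -vfieldD !subrr.
Qed.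

Lemma lie_subproof X Y : (fun f => X (Y f) - Y (X f)) \in derivation_pred.
Proof.
have [Xl XM] := vfield_derivation X; have [Yl YM] := vfield_derivation Y.
apply/asboolP; split=> [a f g|f g].
  by rewrite Yl Xl Xl Yl scalerBr opprD addrACA.
rewrite YM XM !vfieldD !XM !YM.
by ring.
Qed.

Definition lie X Y : vfield := MkVfield (lie_subproof X Y).

(* The value X_p, as the map C^oo(M) -> R. *)
Definition tangent X (p : M) : C -> R := fun f => X f p.

End VectorFields.

Section Geometry.
Context {R : realType} {m : nat} {M : manifold R m}.
Local Notation C := (Cinf M).
Local Notation V := (vfield M).
Implicit Types (X Y Z : V) (f : C).

Record pseudo_metric := PseudoMetric {
  pmetric :> V -> V -> C;
  pmetric_linear : forall f X Y Z,
    pmetric (f *: X + Y) Z = f * pmetric X Z + pmetric Y Z;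
  pmetric_sym : forall X Y, pmetric X Y = pmetric Y X;
  (* The form induced by [pmetric] on each tangent space {X_p} is
     nondegenerate; being C^oo(M)-bilinear, [pmetric X Y p] depends only on
     X_p and Y_p. *)
  pmetric_nondegenerate : forall (p : M) X,
    (forall Y, pmetric X Y p = 0) -> tangent X p = (fun=> 0) }.

Record almost_complex := AlmostComplex {
  acs :> {linear V -> V};
  acs_sqr : forall X, acs (acs X) = - X }.

Definition acs_inv (J : almost_complex) X : V := - J X.

Lemma acsK (J : almost_complex) : cancel J (acs_inv J).
Proof. by move=> X; rewrite /acs_inv acs_sqr opprK. Qed.

Lemma acs_invK (J : almost_complex) : cancel (acs_inv J) J.
Proof. by move=> X; rewrite /acs_inv linearN /= acs_sqr opprK. Qed.

Record connection := Connection {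
  nabla :> V -> V -> V;
  nabla_linear : forall f X Y Z, nabla (f *: X + Y) Z = f *: nabla X Z + nabla Y Z;
  nablaD : forall X Y Z, nabla X (Y + Z) = nabla X Y + nabla X Z;
  nabla_leibniz : forall f X Y, nabla X (f *: Y) = X f *: Y + f *: nabla X Y }.

Definition compatible (g : pseudo_metric) (w : V -> V -> C)
    (J : almost_complex) : Prop :=
  (forall X Y, g (J X) Y = - g X (J Y)) /\ (forall X Y, w X Y = g (J X) Y).

(* [D'] is the [b]-conjugate of [D]; when [b] is nondegenerate (a metric or the
   form of a compatible triple), this determines [D']. *)
Definition conjugate (b : V -> V -> C) (D D' : connection) : Prop :=
  forall X Y Z, Z (b X Y) = b (D Z X) Y + b X (D' Z Y).

Section ConjugateJ.
Variables (J : almost_complex) (D : connection).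

Let nablaJ X Y : V := acs_inv J (D X (J Y)).

Let nablaJ_linear f X Y Z :
  nablaJ (f *: X + Y) Z = f *: nablaJ X Z + nablaJ Y Z.
Proof. by rewrite /nablaJ /acs_inv nabla_linear linearP opprD scalerN. Qed.

Let nablaJD X Y Z : nablaJ X (Y + Z) = nablaJ X Y + nablaJ X Z.
Proof. by rewrite /nablaJ /acs_inv linearD nablaD linearD opprD. Qed.

Let nablaJ_leibniz f X Y : nablaJ X (f *: Y) = X f *: Y + f *: nablaJ X Y.
Proof.
rewrite /nablaJ /acs_inv linearZ /= nabla_leibniz linearD !linearZ /=.
by rewrite acs_sqr opprD scalerN opprK scalerN.
Qed.

Definition conjugateJ : connection :=
  @Connection nablaJ nablaJ_linear nablaJD nablaJ_leibniz.

End ConjugateJ.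

Definition torsion (D : connection) X Y : V := D X Y - D Y X - lie X Y.

Definition cov_endo (D : connection) (J : V -> V) X Y : V :=
  D X (J Y) - J (D X Y).

Definition cov_form (D : connection) (b : V -> V -> C) X Y Z : C :=
  X (b Y Z) - b (D X Y) Z - b Y (D X Z).

Definition d_endo (D : connection) (J : V -> V) X Y : V :=
  cov_endo D J X Y - cov_endo D J Y X + J (torsion D X Y).

Definition d_form (D : connection) (b : V -> V -> C) X Y Z : C :=
  cov_form D b X Y Z - cov_form D b Y X Z + b (torsion D X Y) Z.

Definition torsion_free (D : connection) : Prop :=
  forall X Y, torsion D X Y = 0.

Definition d_endo_zero (D : connection) (J : V -> V) : Prop :=
  forall X Y, d_endo D J X Y = 0.

Definition d_form_zero (D : connection) (b : V -> V -> C) : Prop :=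
  forall X Y Z, d_form D b X Y Z = 0.

End Geometry.

Arguments pseudo_metric {R m} M.
Arguments almost_complex {R m} M.
Arguments connection {R m} M.

(* Main.v *)
(* If D and E are b-conjugate, then (d^D b)(X,Y,Z) = b(T^E(X,Y),Z), and
   d^D J = J T^{D^J} for every D.  Moreover, the group generated by the three
   conjugations is a Klein four-group: *, dagger and J are commuting
   involutions whose product is the identity.  Every condition in a given item
   then says that the same one of the four connections is torsion-free. *)
Require Import Defs.
From mathcomp Require Import all_boot all_order all_algebra.
From mathcomp Require Import all_classical all_reals all_analysis.
From mathcomp Require Import ring.

Import GRing.Theory.
Local Open Scope ring_scope.

Section Conjugation.
Set Implicit Arguments.
Unset Strict Implicit.
Unset Printing Implicit Defensive.
Context {R : realType} {m : nat} {M : manifold R m}.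
Local Notation C := (Cinf M).
Local Notation V := (vfield M).
Implicit Types (g : pseudo_metric M) (J : almost_complex M) (w b : V -> V -> C).
Implicit Types (D E : connection M) (X Y Z : V).

Lemma pmetricBl g X Y Z : g (X - Y) Z = g X Z - g Y Z.
Proof.
have -> : X - Y = (-1) *: Y + X by rewrite scaleN1r addrC.
by rewrite pmetric_linear; ring.
Qed.

Lemma pmetricNl g X Z : g (- X) Z = - g X Z.
Proof. by rewrite -sub0r pmetricBl -{1}(subrr X) pmetricBl subrr sub0r. Qed.

(** Nondegeneracy holds pointwise on tangent vectors, and a vector field is determined by its values
    at all points. *)
Lemma pmetric_eq0 g X : (forall Y, g X Y = 0) -> X = 0.
Proof.
move=> gX0; apply: vfieldP => f; apply: CinfP => p.
have gX0p Y : g X Y p = 0 by rewrite gX0.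
exact: (congr1 (fun t => t f) (@pmetric_nondegenerate _ _ _ g p X gX0p)).
Qed.

(** Conjugacy turns [cov_form D b X Y Z] into [b (E X Y - D X Y) Z]. Antisymmetrising in [X] and [Y]
    gives the difference of the two torsions, and the torsion term of [d_form] cancels that of
    [D]. *)
Lemma d_form_conjugate b D E X Y Z :
  (forall X Y Z, b (X - Y) Z = b X Z - b Y Z) -> conjugate b E D ->
  d_form D b X Y Z = b (torsion E X Y) Z.
Proof.
move=> bB bED; rewrite /d_form /cov_form /torsion !bB !bED.
by ring.
Qed.

Lemma d_form_zero_conjugate b D E :
  (forall X Y Z, b (X - Y) Z = b X Z - b Y Z) ->
  (forall X, (forall Y, b X Y = 0) -> X = 0) ->
  conjugate b E D -> d_form_zero D b <-> torsion_free E.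
Proof.
move=> bB b_eq0 bED; split=> [Db0 X Y|E0 X Y Z].
  by apply: b_eq0 => Z; rewrite -(d_form_conjugate X Y Z bB bED).
rewrite (d_form_conjugate X Y Z bB bED) E0.
by rewrite -(subrr (0 : V)) bB subrr.
Qed.

(** The terms [J (D X Y)] and [J (D Y X)] cancel against [J (torsion D X Y)]; what remains is [J] of
    the torsion, as [J] undoes the [acs_inv] in [conjugateJ]. *)
Lemma d_endo_conjugateJ J D X Y :
  d_endo D J X Y = J (torsion (conjugateJ J D) X Y).
Proof.
rewrite /d_endo /cov_endo /torsion /= /acs_inv !linearB !linearN /=.
rewrite !acs_sqr !opprK.
move: (D X (J Y)) (D Y (J X)) (J (D X Y)) (J (D Y X)) => a b c d.
by rewrite (addrACA a) (addrC (- c)) -(opprB c d) subrKA.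
Qed.

Lemma nablaN D X Y : D X (- Y) = - D X Y.
Proof.
have D0 : D X 0 = 0 by apply: (addrI (D X 0)); rewrite -nablaD !addr0.
by apply: (addrI (D X Y)); rewrite -nablaD !subrr.
Qed.

Lemma d_endo_zero_conjugateJ J D :
  d_endo_zero D J <-> torsion_free (conjugateJ J D).
Proof.
split=> [DJ0 X Y|T0 X Y]; last by rewrite d_endo_conjugateJ T0 linear0.
by apply: (can_inj (acsK J)); rewrite -d_endo_conjugateJ DJ0 linear0.
Qed.

(** Lets connections be compared by values, never as records carrying proofs. *)
Lemma eq_torsion_free D E :
  (forall X Y, D X Y = E X Y) -> torsion_free D <-> torsion_free E.
Proof.
by move=> DE; split=> T0 X Y; rewrite -(T0 X Y) /torsion !DE.
Qed.

Lemma conjugateJK J D X Y : conjugateJ J (conjugateJ J D) X Y = D X Y.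
Proof.
by rewrite /= /acs_inv !acs_sqr nablaN linearN opprK acs_sqr opprK.
Qed.

Lemma conjugate_metric_sym g D E : conjugate g D E -> conjugate g E D.
Proof.
move=> gDE X Y Z; rewrite pmetric_sym gDE addrC (pmetric_sym g Y).
by rewrite (pmetric_sym g _ X).
Qed.

(** As conjugacy is a relation, this uniqueness is what identifies two connections. *)
Lemma conjugate_metric_inj g D E E' :
  conjugate g D E -> conjugate g D E' -> forall X Y, E X Y = E' X Y.
Proof.
move=> gDE gDE' Z Y; apply/eqP; rewrite -subr_eq0; apply/eqP.
apply: (@pmetric_eq0 g) => X; rewrite pmetricBl !(pmetric_sym _ _ X).
by apply/eqP; rewrite subr_eq0; apply/eqP/(addrI (g (D Z X) Y)); rewrite -gDE -gDE'.
Qed.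

Section Compatible.
Variables (g : pseudo_metric M) (w : V -> V -> C) (J : almost_complex M).
Hypothesis gwJ : compatible g w J.

Lemma compatible_formE X Y : w X Y = g (J X) Y. Proof. exact: gwJ.2. Qed.

Lemma compatible_formBl X Y Z : w (X - Y) Z = w X Z - w Y Z.
Proof. by rewrite !compatible_formE linearB pmetricBl. Qed.

Lemma compatible_form_eq0 X : (forall Y, w X Y = 0) -> X = 0.
Proof.
move=> wX0; apply: (can_inj (acsK J)); rewrite linear0.
by apply: (@pmetric_eq0 g) => Y; rewrite -compatible_formE.
Qed.

Lemma compatible_form_antisym X Y : w X Y = - w Y X.
Proof. by rewrite !compatible_formE gwJ.1 pmetric_sym. Qed.

Lemma conjugate_form_sym D E : conjugate w D E -> conjugate w E D.
Proof.
move=> wDE X Y Z; rewrite compatible_form_antisym vfieldN wDE opprD addrC.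
by rewrite -!compatible_form_antisym.
Qed.

(** Put [J X] for [X]: both [w (J X) Y] and [w (D Z (J X)) Y] become metric terms with a minus sign,
    by [J (J X) = - X] and [acs_inv J = - J]. *)
Lemma conjugate_form_metric D E :
  conjugate w D E -> conjugate g (conjugateJ J D) E.
Proof.
move=> wDE X Y Z; have := wDE (J X) Y Z.
rewrite !compatible_formE acs_sqr !pmetricNl vfieldN.
by move/(congr1 -%R); rewrite opprD !opprK.
Qed.

(** Here [J] moves to the second slot, [w X Y = - g X (J Y)], so conjugacy is applied to [X] and
    [J Y]. *)
Lemma conjugate_metric_form D E :
  conjugate g D E -> conjugate w D (conjugateJ J E).
Proof.
move=> gDE X Y Z; rewrite !compatible_formE !gwJ.1 vfieldN gDE opprD.
by rewrite /= /acs_inv linearN /= acs_sqr opprK.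
Qed.

End Compatible.
End Conjugation.

Theorem proposition5 (R : realType) (n : nat) (N : manifold R (2 * n))
    (g : pseudo_metric N) (nabla : connection N)
    (omega : vfield N -> vfield N -> Cinf N) (J : almost_complex N)
    (nabla_star nabla_dagger : connection N) :
  compatible g omega J ->
  conjugate g nabla nabla_star ->
  conjugate omega nabla nabla_dagger ->
  let nabla_J := conjugateJ J nabla in
  ((d_form_zero nabla omega <-> torsion_free nabla_dagger) /\
   (torsion_free nabla_dagger <-> d_endo_zero nabla_star J) /\
   (d_endo_zero nabla_star J <-> d_form_zero nabla_J g)) /\
  ((d_form_zero nabla_star omega <-> torsion_free nabla_J) /\
   (torsion_free nabla_J <-> d_endo_zero nabla J) /\
   (d_endo_zero nabla J <-> d_form_zero nabla_dagger g)) /\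
  ((d_form_zero nabla_dagger omega <-> torsion_free nabla) /\
   (torsion_free nabla <-> d_endo_zero nabla_J J) /\
   (d_endo_zero nabla_J J <-> d_form_zero nabla_star g)) /\
  ((d_form_zero nabla_J omega <-> torsion_free nabla_star) /\
   (torsion_free nabla_star <-> d_endo_zero nabla_dagger J) /\
   (d_endo_zero nabla_dagger J <-> d_form_zero nabla g)).
Proof.
move=> gwJ g_star w_dagger nabla_J.
have gJ_dagger : conjugate g nabla_J nabla_dagger :=
  conjugate_form_metric gwJ w_dagger.
have w_starJ : conjugate omega nabla_star nabla_J :=
  conjugate_metric_form gwJ (conjugate_metric_sym g_star).
(* Both sides are [g]-conjugate to [nabla_J]. *)
have star_J X Y : conjugateJ J nabla_star X Y = nabla_dagger X Y.
  apply/esym; apply: (conjugate_metric_inj gJ_dagger).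
  exact: (conjugate_form_metric gwJ (conjugate_metric_form gwJ g_star)).
have dagger_J X Y : conjugateJ J nabla_dagger X Y = nabla_star X Y.
  by rewrite -[RHS](conjugateJK J) /= -!star_J.
have dw D E := @d_form_zero_conjugate _ _ _ omega D E
  (compatible_formBl gwJ) (compatible_form_eq0 gwJ).
have dg D E := @d_form_zero_conjugate _ _ _ g D E
  (pmetricBl g) (@pmetric_eq0 _ _ _ g).
have dJ (D E : connection N) : (forall X Y, conjugateJ J D X Y = E X Y) ->
    d_endo_zero D J <-> torsion_free E.
  move=> DJE; rewrite d_endo_zero_conjugateJ.
  exact: eq_torsion_free.
(* Each of the three conjugations splits the four connections into two pairs. Reading every pair
   both ways gives twelve equivalences, one for each condition on [omega], [J] or [g]. *)
have [dw1 dw2] := (dw _ _ w_dagger, dw _ _ (conjugate_form_sym gwJ w_dagger)).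
have [dw3 dw4] := (dw _ _ w_starJ, dw _ _ (conjugate_form_sym gwJ w_starJ)).
have [dg1 dg2] := (dg _ _ g_star, dg _ _ (conjugate_metric_sym g_star)).
have [dg3 dg4] := (dg _ _ gJ_dagger, dg _ _ (conjugate_metric_sym gJ_dagger)).
have [dJ1 dJ2] := (dJ _ _ star_J, dJ _ _ dagger_J).
have dJ3 := dJ _ _ (conjugateJK J nabla).
have dJ4 := dJ nabla nabla_J (fun _ _ => erefl).
by tauto.
Qed.
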